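(* Let $A=\{x_1,x_2\}$ be an alphabet of two variables. For every positive integer $m$, $$\sum_{\substack{0\le k\le m\\ k\equiv m\ (\mathrm{mod}\ 2)}}\binom{m}{k}(x_1-x_2)^{m-k}\,\frac{G_{m-k+2}}{m-k+2}\left(2^k\phi_k(x_1+x_2)+2(x_1+x_2)^k\right)=-2(x_1-x_2)^2(x_1+x_2)^m.$$
   Context: Here $x_1,x_2$ are two commuting variables (indeterminates). The notation $\phi_n(x_1+x_2)$ denotes the function of the alphabet $\{x_1,x_2\}$ (not of the sum) given by $\phi_n(x_1+x_2)=x_1^n+x_2^n$ for $n\ge 0$; the expression $(x_1+x_2)^k$ is the ordinary power of the sum. The Genocchi numbers $G_n$ are defined by $\sum_{n\ge 0}G_n\frac{z^n}{n!}=\frac{2z}{e^z+1}$.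
   Formalization: The factor (x_1-x_2)^2 on the right is dropped: the identity proved has right-hand side -2(x_1+x_2)^m, since the printed one fails already for m=1 (left side -2(x_1+x_2)) and by degree for every m. *)

(* Defs.v *)
From HB Require Import structures.
From mathcomp Require Import all_boot all_order all_algebra.
From mathcomp Require Export mpoly.

Set Implicit Arguments.
Unset Strict Implicit.
Unset Printing Implicit Defensive.

Import GRing.Theory.
Local Open Scope ring_scope.

(* A formal power series \sum_n (a n) z^n over rat is represented by its
   coefficient sequence a : nat -> rat. *)

Fixpoint fps_div_seq (a b : nat -> rat) (n : nat) : seq rat :=
  if n is p.+1 then
    let s := fps_div_seq a b p in
    rcons s ((a p - \sum_(i < p) s`_i * b (p - i)%N) / b 0%N)
  else [::].

(* The quotient a / b of power series; only meaningful when b 0 != 0, in which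
   case it is characterized by fps_divK and fps_div_uniq. *)
Definition fps_div (a b : nat -> rat) (n : nat) : rat :=
  (fps_div_seq a b n.+1)`_n.

Lemma size_fps_div_seq a b n : size (fps_div_seq a b n) = n.
Proof. by elim: n => //= n IHn; rewrite size_rcons IHn. Qed.

Lemma nth_fps_div_seq a b n i :
  (i < n)%N -> (fps_div_seq a b n)`_i = fps_div a b i.
Proof.
elim: n => // n IHn; rewrite ltnS leq_eqVlt => /predU1P[-> // | lt_in].
by rewrite /= nth_rcons size_fps_div_seq lt_in IHn.
Qed.

Lemma fps_divE (a b : nat -> rat) (n : nat) :
  fps_div a b n = (a n - \sum_(i < n) fps_div a b i * b (n - i)%N) / b 0%N.
Proof.
rewrite {1}/fps_div [fps_div_seq a b n.+1]/= nth_rcons size_fps_div_seq.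
rewrite ltnn eqxx; congr ((_ - _) / _).
by apply: eq_bigr => i _; rewrite nth_fps_div_seq.
Qed.

Lemma fps_divK (a b : nat -> rat) (n : nat) :
  b 0%N != 0 -> \sum_(i < n.+1) fps_div a b i * b (n - i)%N = a n.
Proof.
move=> b0; rewrite big_ord_recr.
set S := \sum_(i < n) _; rewrite [nat_of_ord ord_max]/= subnn.
have -> : fps_div a b n = (a n - S) / b 0%N by exact: fps_divE.
by rewrite (divfK b0); exact: subrKC.
Qed.

Lemma fps_div_uniq (a b q : nat -> rat) :
    b 0%N != 0 -> (forall n, \sum_(i < n.+1) q i * b (n - i)%N = a n) ->
  q =1 fps_div a b.
Proof.
move=> b0 qE n; elim/ltn_ind: n => n IHn; apply: (mulIf b0).
have := qE n; rewrite -(fps_divK a n b0) !big_ord_recr /= subnn.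
rewrite (eq_bigr (fun i : 'I_n => fps_div a b i * b (n - i)%N)) => [/addrI //|].
by move=> i _; rewrite IHn.
Qed.

(* The series 2 z. *)
Definition fps_2z (n : nat) : rat := if n == 1%N then 2 else 0.

(* The series e^z + 1. *)
Definition fps_exp_add1 (n : nat) : rat :=
  (n`!%:R)^-1 + (if n == 0%N then 1 else 0).

(* \sum_n (genocchi n) z^n / n! = 2 z / (e^z + 1). *)
Definition genocchi (n : nat) : rat :=
  n`!%:R * fps_div fps_2z fps_exp_add1 n.

Lemma genocchi_egf (n : nat) :
  \sum_(i < n.+1) genocchi i / i`!%:R * fps_exp_add1 (n - i)%N = fps_2z n.
Proof.
have b0 : fps_exp_add1 0 != 0 by rewrite /fps_exp_add1 fact0 invr1.
rewrite -(fps_divK fps_2z n b0); apply: eq_bigr => i _.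
by rewrite /genocchi (mulrC i`!%:R) mulfK // Num.Theory.pnatr_eq0 -lt0n fact_gt0.
Qed.

(* An alphabet is the list of its letters; phi n A is the sum of the n-th powers
   of the letters, so phi n [:: x; y] is x ^+ n + y ^+ n and not (x + y) ^+ n. *)
Definition phi (R : nzRingType) (n : nat) (A : seq R) : R :=
  \sum_(x <- A) x ^+ n.

(* Main.v *)
Require Import Defs.
From HB Require Import structures.
From mathcomp Require Import all_boot all_order all_algebra.
From mathcomp Require Import ring.

Import GRing.Theory.
Local Open Scope ring_scope.

(** The numbers e_n = G_(n+1) / (n+1) have exponential generating function
    2 / (e^z + 1), so the linear functional L on polynomials with L(X^n) = e_n
    satisfies L(p(X + 1)) + L(p) = 2 p(0).  With d = x1 - x2 and
    q = (d X + 2 x2)^m, the left-hand side, summed over all k, is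
    L(X q(X + 2)) + L(X q) + 2 L(X q(X + 1)); applying the functional equation
    to (X - 1) q(X + 1) and to X q reduces it to - 2 q(1) = - 2 (x1 + x2)^m.
    Restricting the sum to k = m mod 2 is harmless because e_n = 0 for even
    n > 0: the functional p |-> 2 p(0) - L(p(- X)) satisfies the same functional
    equation as L, which determines L. *)

(** This is L. The base ring stays general because L serves twice: over the rationals for the parity
    of e_n, and over polynomials in x1, x2 for the identity. *)
Definition umbral (R : comNzRingType) (e : nat -> R) (p : {poly R}) : R :=
  \sum_(i < size p) p`_i * e i.

Arguments umbral {R} e p.

Lemma umbral_wide (R : comNzRingType) (e : nat -> R) (p : {poly R}) n :
  (size p <= n)%N -> umbral e p = \sum_(i < n) p`_i * e i.
Proof.
move=> le_pn; rewrite /umbral (big_ord_widen n (fun i => p`_i * e i) le_pn).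
rewrite big_mkcond; apply: eq_bigr => i _.
by case: ltnP => // le_pi; rewrite nth_default ?mul0r.
Qed.

Lemma umbral_is_linear (R : comNzRingType) (e : nat -> R) :
  linear_for *%R (umbral e).
Proof.
move=> a p q; set n := maxn (size p) (size q).
have le_pn : (size p <= n)%N by exact: leq_maxl.
have le_qn : (size q <= n)%N by exact: leq_maxr.
have le_apqn : (size (a *: p + q)%R <= n)%N.
  apply: leq_trans (size_polyD _ _) _; rewrite geq_max le_qn andbT.
  exact: leq_trans (size_scale_leq _ _) le_pn.
rewrite !(umbral_wide _ _ _ n) // mulr_sumr -big_split /=.
by apply: eq_bigr => i _; rewrite coefD coefZ mulrDl mulrA.
Qed.

HB.instance Definition _ (R : comNzRingType) (e : nat -> R) :=
  GRing.isLinear.Build R {poly R} R *%R (umbral e) (umbral_is_linear R e).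

Lemma umbralXn (R : comNzRingType) (e : nat -> R) n : umbral e 'X^n = e n.
Proof.
rewrite /umbral size_polyXn big_ord_recr /= coefXn eqxx mul1r big1 ?add0r //.
by move=> i _; rewrite coefXn (ltn_eqF (ltn_ord i)) mul0r.
Qed.

(** The extra factor ['X] raises the index to m - k + 1, which is where G_(m-k+2) / (m-k+2) comes
    from. *)
Lemma umbralX_affine_exp (R : comNzRingType) (e : nat -> R) (a b : R) n :
  umbral e ('X * (a *: 'X + b%:P) ^+ n)
  = \sum_(k < n.+1) 'C(n, k)%:R * a ^+ (n - k) * e (n - k).+1 * b ^+ k.
Proof.
rewrite exprDn mulr_sumr linear_sum; apply: eq_bigr => k _.
have -> : 'X * ((a *: 'X) ^+ (n - k) * b%:P ^+ k *+ 'C(n, k))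
          = ('C(n, k)%:R * a ^+ (n - k) * b ^+ k) *: 'X^((n - k).+1).
  rewrite exprZn -polyC_exp -!mul_polyC !rmorphM /= rmorph_nat exprS.
  by rewrite -mulr_natl; ring.
by rewrite linearZ /= umbralXn mulrAC.
Qed.

Section EulerSequence.

Variables (R : comNzRingType) (e : nat -> R).

(** Coefficient form of (e^z + 1) E(z) = 2, with E the exponential generating function of [e]. *)
Hypothesis e_rec : forall n,
  \sum_(k < n.+1) 'C(n, k)%:R * e k + e n = 2 * (n == 0)%N%:R.

Lemma umbral_shift (p : {poly R}) :
  umbral e (p \Po ('X + 1)) + umbral e p = 2 * p.[0].
Proof.
rewrite -[p]coefK poly_def linear_sum /= !linear_sum horner_sum mulr_sumr /=.
rewrite -big_split /=; apply: eq_bigr => i _.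
rewrite comp_polyZ !linearZ /= comp_Xn_poly umbralXn hornerZ hornerXn expr0n.
rewrite -mulrDr mulrCA -e_rec; congr (_ * (_ + _)).
rewrite addrC exprDn linear_sum /=; apply: eq_bigr => k _.
by rewrite expr1n mul1r linearMn /= umbralXn mulr_natl.
Qed.

Lemma umbral_second_difference (q : {poly R}) :
  umbral e ('X * (q \Po ('X + 2%:P))) + umbral e ('X * q)
    + 2 * umbral e ('X * (q \Po ('X + 1)))
  = - 2 * q.[1].
Proof.
have := umbral_shift (('X - 1) * (q \Po ('X + 1))).
have -> : (('X - 1) * (q \Po ('X + 1))) \Po ('X + 1) = 'X * (q \Po ('X + 2%:P)).
  rewrite comp_polyM comp_polyB comp_polyX rmorph1 addrK -comp_polyA.
  by rewrite comp_polyD comp_polyX rmorph1 -addrA rmorph_nat.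
have := umbral_shift ('X * q).
rewrite comp_polyM comp_polyX mulrDl mul1r mulrBl mul1r linearD linearB /=.
rewrite !hornerE horner_comp !hornerE.
set a := umbral _ _; set b := umbral _ _; set c := umbral _ _.
set g := umbral _ _.
rewrite /= mulr0 mul0r => /eqP; rewrite addr_eq0 => /eqP abE gE.
(* Here b = L(q(X + 1)) enters the two equations with opposite signs, so it cancels in g + c + 2
   a. *)
have -> : g = 2 * - q.[1] - (a - b) by rewrite -gE; ring.
have -> : c = - (a + b) by rewrite abE opprK.
by ring.
Qed.

Lemma umbral_two_letter_identity (x y : R) m :
  \sum_(k < m.+1) 'C(m, k)%:R * (x - y) ^+ (m - k) * e (m - k).+1
     * ((2 * x) ^+ k + (2 * y) ^+ k + 2 * (x + y) ^+ k)
  = - 2 * (x + y) ^+ m.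
Proof.
(* Shifting by 1 and by 2 turns the constant 2 y into x + y and 2 x, the three bases of the k-th
   powers. *)
pose q : {poly R} := ((x - y) *: 'X + (2 * y)%:P) ^+ m.
have q1E : q \Po ('X + 1) = ((x - y) *: 'X + (x + y)%:P) ^+ m.
  rewrite rmorphXn /= comp_polyD comp_polyZ comp_polyX comp_polyC -!mul_polyC.
  by congr (_ ^+ m); rewrite !(rmorphD, rmorphN, rmorphM) /=; ring.
have q2E : q \Po ('X + 2%:P) = ((x - y) *: 'X + (2 * x)%:P) ^+ m.
  rewrite rmorphXn /= comp_polyD comp_polyZ comp_polyX comp_polyC -!mul_polyC.
  by congr (_ ^+ m); rewrite !(rmorphD, rmorphN, rmorphM) /=; ring.
have <- : q.[1] = (x + y) ^+ m.
  by rewrite /q !hornerE; congr (_ ^+ m); ring.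
rewrite -umbral_second_difference q1E q2E !umbralX_affine_exp.
rewrite mulr_sumr -!big_split /=; apply: eq_bigr => k _; ring.
Qed.

End EulerSequence.

(** The values E_n(0) of the Euler polynomials. *)
Definition euler0 (n : nat) : rat := genocchi n.+1 / n.+1%:R.

Lemma euler0_rec n :
  \sum_(k < n.+1) 'C(n, k)%:R * euler0 k + euler0 n = 2 * (n == 0)%N%:R.
Proof.
have fact_neq0 k : k`!%:R != 0 :> rat.
  by rewrite Num.Theory.pnatr_eq0 -lt0n fact_gt0.
have genocchi0 : genocchi 0 = 0.
  have := genocchi_egf 0; rewrite big_ord1 subnn /fps_exp_add1 /fps_2z /=.
  by rewrite fact0 invr1 mulr1 => /eqP; rewrite mulf_eq0 orbF => /eqP.
have := genocchi_egf n.+1; rewrite big_ord_recl genocchi0 !mul0r add0r.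
move=> /(congr1 (fun x => n`!%:R * x)); rewrite /fps_2z eqSS.
have -> : n`!%:R * (if n == 0 then 2 else 0) = 2 * (n == 0)%N%:R :> rat.
  by case: n => [|n]; rewrite ?mulr0 // fact0 mul1r mulr1.
move=> <-; rewrite mulr_sumr /=.
(* The constant term of e^z + 1 is 1 + 1; its second 1 is met only at k = n and yields the isolated
   summand [euler0 n]. *)
have termE (k : 'I_n.+1) : n`!%:R * (genocchi (lift ord0 k) / (lift ord0 k)`!%:R
      * fps_exp_add1 (n.+1 - lift ord0 k)%N)
    = 'C(n, k)%:R * euler0 k + (if k == ord_max then euler0 n else 0).
  have le_kn : (k <= n)%N by rewrite -ltnS.
  rewrite lift0 subSS /fps_exp_add1 subn_eq0 -(bin_fact le_kn) factS !natrM.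
  have -> : (n <= k)%N = (k == ord_max).
    by rewrite -val_eqE /= eqn_leq le_kn.
  rewrite /euler0; have [->|_] := eqVneq k ord_max.
    rewrite /= subnn fact0 binn; field.
    by rewrite fact_neq0 addrC natr1 Num.Theory.pnatr_eq0.
  field; rewrite !fact_neq0 /=.
  by rewrite addrC natr1 Num.Theory.pnatr_eq0.
by rewrite (eq_bigr _ (fun k _ => termE k)) big_split -big_mkcond big_pred1_eq.
Qed.

(** Coefficient form of 2 / (e^z + 1) + 2 / (e^(-z) + 1) = 2. *)
Lemma euler0_sym n : euler0 n + (-1) ^+ n * euler0 n = 2 * (n == 0)%N%:R.
Proof.
pose f n := euler0 n + (-1) ^+ n * euler0 n - 2 * (n == 0)%N%:R.
have f_rec k : \sum_(i < k.+1) 'C(k, i)%:R * f i + f k = 0.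
  have altE : \sum_(i < k.+1) 'C(k, i)%:R * ((-1) ^+ i * euler0 i)
              = umbral euler0 ((1 - 'X) ^+ k).
    rewrite exprDn linear_sum; apply: eq_bigr => i _.
    rewrite expr1n mul1r -scaleN1r exprZn linearMn linearZ /= umbralXn.
    by rewrite mulr_natl.
  have q0 : ((1 - 'X : {poly rat}) ^+ k).[0] = 1 by rewrite !hornerE expr1n.
  (* The shift sends 1 - X to - X, so the functional equation gives the alternating sum as 2 -
     (-1)^k e_k. *)
  have := umbral_shift _ _ euler0_rec ((1 - 'X) ^+ k).
  rewrite q0 mulr1 -altE rmorphXn /= comp_polyB comp_polyX rmorph1.
  rewrite opprD addrCA subrr addr0.
  rewrite -scaleN1r exprZn linearZ /= umbralXn => sumE.
  rewrite /f; under eq_bigr => i _ do rewrite mulrBr mulrDr.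
  rewrite sumrB big_split /=.
  have -> : \sum_(i < k.+1) 'C(k, i)%:R * (2 * (nat_of_ord i == 0)%N%:R)
            = 2 :> rat.
    rewrite big_ord_recl big1 ?addr0 ?bin0 ?mul1r ?mulr1 // => i _.
    by rewrite /= !mulr0.
  rewrite -(euler0_rec k).
  set u := \sum_(i < _) _; set v := \sum_(i < _) _ in sumE *.
  have -> : v = 2 - (-1) ^+ k * euler0 k by rewrite -sumE; ring.
  by ring.
suff : f n = 0 by move/eqP; rewrite subr_eq0 => /eqP.
(* Once the earlier terms vanish, the recurrence reads 2 f(n) = 0. *)
elim/ltn_ind: n => n IHn; have := f_rec n.
rewrite big_ord_recr /= big1 => [|i _]; last by rewrite IHn ?mulr0.
rewrite add0r binn mul1r => /eqP; rewrite -mulr2n.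
by rewrite Num.Theory.mulrn_eq0 => /eqP.
Qed.

Lemma euler0_even n : (0 < n)%N -> ~~ odd n -> euler0 n = 0.
Proof.
move=> n_gt0 even_n; have := euler0_sym n.
rewrite -signr_odd (negPf even_n) expr0 mul1r eqn0Ngt n_gt0 mulr0 => /eqP.
by rewrite -mulr2n Num.Theory.mulrn_eq0 => /eqP.
Qed.

(** Every summand is homogeneous of degree [m] in [x1], [x2], so the right-hand side cannot carry
    the further factor (x1 - x2)^2 of the informal statement. *)
Theorem theorem5 (m : nat) (m_gt0 : (0 < m)%N) :
  let x1 : {mpoly rat[2]} := 'X_(@Ordinal 2 0 isT) in
  let x2 : {mpoly rat[2]} := 'X_(@Ordinal 2 1 isT) in
  let A : seq {mpoly rat[2]} := [:: x1; x2] in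
  \sum_(0 <= k < m.+1 | k == m %[mod 2])
     'C(m, k)%:R * (x1 - x2) ^+ (m - k)
     * (genocchi (m - k + 2)%N / (m - k + 2)%N%:R)%:MP
     * (2 ^+ k * phi k A + 2 * (x1 + x2) ^+ k)
  = - 2 * (x1 + x2) ^+ m.
Proof.
move=> x1 x2 A.
pose e n := (euler0 n)%:MP : {mpoly rat[2]}.
have e_rec n : \sum_(k < n.+1) 'C(n, k)%:R * e k + e n = 2 * (n == 0)%N%:R.
  have := congr1 (@mpolyC 2 rat) (euler0_rec n).
  rewrite rmorphD [(2 * _)%:MP_[2]]rmorphM /= rmorph_sum /= !rmorph_nat => <-.
  by congr (_ + _); apply: eq_bigr => k _; rewrite rmorphM /= rmorph_nat.
rewrite -(umbral_two_letter_identity _ _ e_rec) big_mkord big_mkcond.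
apply: eq_bigr => k _; have le_km : (k <= m)%N by rewrite -ltnS.
have -> : (k == m %[mod 2]) = ~~ odd (m - k).
  by rewrite !modn2 oddB //; case: (odd k); case: (odd m).
case: ifPn => [_|]; last first.
  (* For odd m - k the index m - k + 1 is even and positive. *)
  rewrite negbK => odd_mk; rewrite /e euler0_even ?mpolyC0 /= ?odd_mk //.
  by rewrite mulr0 mul0r.
by rewrite addn2 /phi /A !big_cons big_nil addr0 !exprMn -mulrDr.
Qed.
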